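(* Let $p$ be a prime number with $p\equiv 1\pmod 4$. Then there does not exist a Butson Hadamard matrix $BH(p+1,2p)$.
   Context: A Butson Hadamard matrix $BH(n,q)$ is an $n\times n$ complex matrix all of whose entries are $q$th roots of unity and whose rows are pairwise orthogonal with respect to the standard complex inner product on $\mathbb{C}^n$. *)

(* Defs.v *)
From HB Require Import structures.
From mathcomp Require Import all_boot all_order all_algebra.
From mathcomp Require Import complex reals.

Set Implicit Arguments.
Unset Strict Implicit.
Unset Printing Implicit Defensive.

Import Order.TTheory GRing.Theory Num.Theory.
Local Open Scope ring_scope.

Definition hermitian_dot (C : numClosedFieldType) (n : nat) (u v : 'rV[C]_n) : C :=
  \sum_(k < n) u 0 k * (v 0 k)^*.

Definition butson_hadamard (C : numClosedFieldType) (n q : nat) (H : 'M[C]_n) : Prop :=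
  (forall i j : 'I_n, q.-unity_root (H i j)) /\
  (forall i j : 'I_n, i != j -> hermitian_dot (row i H) (row j H) = 0).

(* Main.v *)
(** A vanishing sum of p + 1 terms +-zeta^a, with zeta a primitive p-th root of
    unity, has its sum of signs divisible by p, because the minimal polynomial
    of zeta takes the value p at 1. This sum of signs is even and at most
    p + 1 < 2p in absolute value, hence zero. So replacing every entry h of a
    BH(p+1, 2p) by its sign h^p yields a real Hadamard matrix of order p + 1,
    which is impossible: three pairwise orthogonal rows of signs force
    4 | p + 1. *)

Require Import Defs.
From HB Require Import structures.
From mathcomp Require Import all_boot all_order all_algebra.
From mathcomp Require Import complex reals.
From mathcomp Require Import qpoly zify ring.

Import Order.TTheory GRing.Theory Num.Theory.
Local Open Scope ring_scope.

(* ((1 + X)^p - 1) / X *)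
Definition shifted_cyclotomic (p : nat) : {poly int} :=
  \poly_(i < p) ('C(p, i.+1))%:Z.

Lemma size_shifted_cyclotomic (p : nat) :
  (0 < p)%N -> size (shifted_cyclotomic p) = p.
Proof. by case: p => // p _; rewrite size_poly_eq //= binn. Qed.

Lemma shifted_cyclotomic_monic (p : nat) :
  (0 < p)%N -> shifted_cyclotomic p \is monic.
Proof. by case: p => // p _; rewrite monicE lead_coef_poly //= binn. Qed.

Lemma coef0_shifted_cyclotomic (p : nat) :
  (0 < p)%N -> (shifted_cyclotomic p)`_0 = p%:Z.
Proof. by move=> p_gt0; rewrite coef_poly p_gt0 bin1. Qed.

Lemma horner_shifted_cyclotomic (A : comNzRingType) (p : nat) (x : A) :
  x * (map_poly intr (shifted_cyclotomic p)).[x] = (1 + x) ^+ p - 1.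
Proof.
rewrite exprDn big_ord_recl /= expr1n mulr1 bin0 addrC addKr.
have -> : map_poly intr (shifted_cyclotomic p) =
    \poly_(i < p) ('C(p, i.+1))%:R :> {poly A}.
  apply/polyP=> i; rewrite coef_map !coef_poly.
  by case: ifP; rewrite /= ?mulrz_nat.
rewrite horner_poly mulr_sumr; apply: eq_bigr => i _.
by rewrite expr1n mul1r /bump /= add1n exprS -mulr_natl; ring.
Qed.

(** Eisenstein at p: the leading coefficient is 1, p divides every other binomial coefficient, and
    the constant coefficient is p itself, not divisible by p squared. *)
Lemma shifted_cyclotomic_irreducible (p : nat) :
  prime p -> irreducible_poly (shifted_cyclotomic p).
Proof.
move=> p_pr; have p_gt0 := prime_gt0 p_pr; have p_gt1 := prime_gt1 p_pr.
have size_E := size_shifted_cyclotomic _ p_gt0.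
apply: (@eisenstein_crit p) => //.
- by rewrite size_E; case: p p_gt1 {p_pr p_gt0 size_E} => [|[|]].
- rewrite (monicP (shifted_cyclotomic_monic _ p_gt0)).
  by rewrite dvdzE /= dvdn1; case: p p_gt1 {p_pr p_gt0 size_E} => [|[|]].
- rewrite coef0_shifted_cyclotomic // dvdzE !absz_nat natrXE.
  by rewrite -{2}[p]expn1 dvdn_Pexp2l.
- move=> i; rewrite size_E => lt_ip.
  rewrite coef_poly; have -> : (i < p)%N by lia.
  by rewrite dvdzE /= prime_dvd_bin //; lia.
Qed.

(** If P did not divide Q, the two would be coprime, and a Bezout relation with right-hand side a
    nonzero integer [d], evaluated at x, would give d = 0. Being monic, P is primitive, so by Gauss
    the quotient is integral. *)
Lemma irreducible_int_common_root (C : numFieldType) (P Q : {poly int}) (x : C) :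
    irreducible_poly P -> P \is monic ->
    root (map_poly intr P) x -> root (map_poly intr Q) x ->
  exists S : {poly int}, Q = P * S.
Proof.
move=> P_irr P_monic /rootP Px0 /rootP Qx0.
suff /dvdpP_int[S ->] : P %| Q by exists S; rewrite zprimitive_monic.
apply/negPn; rewrite -irreducible_poly_coprime //; apply/negP.
case/Bezout_coprimepP=> -[u v] /= /eqpP[[c d] /= /andP[_ d_neq0] Bezout].
move/(congr1 (fun T => (map_poly intr T : {poly C}).[x])): Bezout.
rewrite !linearZ /= rmorphD !rmorphM rmorph1 !hornerE /= Px0 Qx0.
by rewrite !mulr0 addr0 mulr0 => /eqP; rewrite eq_sym intr_eq0 (negPf d_neq0).
Qed.

Lemma prime_primitive_root_exists (C : numClosedFieldType) (p : nat) :
  prime p -> exists2 y : C, root (map_poly intr (shifted_cyclotomic p)) y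
    & p.-primitive_root (1 + y).
Proof.
move=> p_pr; have p_gt0 := prime_gt0 p_pr; have p_gt1 := prime_gt1 p_pr.
have [|y y_root] := @closed_rootP C (map_poly intr (shifted_cyclotomic p)) _.
  rewrite size_map_inj_poly ?size_shifted_cyclotomic //; last exact: intr_inj.
  by case: p p_gt1 {p_pr p_gt0} => [|[|]].
exists y => //.
have y1p : (1 + y) ^+ p = 1.
  have := horner_shifted_cyclotomic _ p y; rewrite (rootP y_root) mulr0.
  by move/eqP; rewrite eq_sym subr_eq0 => /eqP.
have [m m_prim] := prim_order_exists p_gt0 y1p.
case/primeP: p_pr => _ /[apply] /orP[] /eqP m_eq; last by rewrite m_eq in m_prim.
(* Order 1 would mean y = 0, but the constant coefficient p is nonzero. *)
have := prim_expr_order m_prim; rewrite m_eq expr1 -{2}[1]addr0 => /addrI y0.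
move: y_root; rewrite y0 /root horner_coef0 coef_map /=.
by rewrite coef0_shifted_cyclotomic // intr_eq0; case: p p_gt0 {p_gt1 y1p}.
Qed.

(* With 1 + X in place of the root of unity, the vanishing relation becomes a
   multiple of the shifted cyclotomic polynomial; compare values at X = 0. *)
Lemma dvd_sum_signs (C : numClosedFieldType) (p n : nat)
    (z : 'I_n -> C) (s : 'I_n -> bool) :
    prime p -> odd p -> (forall k, z k ^+ p = (-1) ^+ s k) ->
    \sum_k z k = 0 ->
  (p %| \sum_k (-1) ^+ s k)%Z.
Proof.
move=> p_pr p_odd zp z_sum0; have p_gt0 := prime_gt0 p_pr.
have [y y_root y_prim] := prime_primitive_root_exists C p p_pr.
have z_pow k : exists i : 'I_p, z k == (-1) ^+ s k * (1 + y) ^+ i.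
  (* As p is odd, a sign is its own p-th power, so multiplying by it turns [z k] into a p-th root of
     unity. *)
  have : ((-1) ^+ s k * z k) ^+ p = 1.
    rewrite exprMn zp -exprM mulnC exprM -[(-1) ^+ p]signr_odd p_odd expr1.
    by rewrite -expr2 sqrr_sign.
  by case/(prim_rootP y_prim)=> i i_eq; exists i; rewrite -i_eq signrMK.
pose a k := xchoose (z_pow k).
have z_eq k : z k = (-1) ^+ s k * (1 + y) ^+ a k.
  exact/eqP/(xchooseP (z_pow k)).
pose Q : {poly int} := \sum_k (-1) ^+ s k * (1 + 'X) ^+ a k.
have Q_root : root (map_poly intr Q) y.
  rewrite /root rmorph_sum /= horner_sum -[X in _ == X]z_sum0; apply/eqP.
  apply: eq_bigr => k _; rewrite z_eq rmorphM rmorphXn rmorphN1.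
  by rewrite rmorphXn rmorphD rmorph1 /= map_polyX !hornerE.
have [S Q_eq] := irreducible_int_common_root _ _ _ _
  (shifted_cyclotomic_irreducible p p_pr) (shifted_cyclotomic_monic p p_gt0)
  y_root Q_root.
have <- : Q.[0] = \sum_k (-1) ^+ s k.
  rewrite /Q horner_sum; apply: eq_bigr => k _.
  by rewrite !hornerE expr1n mulr1.
by rewrite Q_eq hornerM horner_coef0 coef0_shifted_cyclotomic // dvdz_mulr.
Qed.

Lemma sum_signs (A : pzRingType) (n : nat) (s : 'I_n -> bool) :
  \sum_k (-1) ^+ s k = n%:R - 2 * (\sum_k s k)%:R :> A.
Proof.
rewrite natr_sum mulr_sumr -[X in X%:R]card_ord -sum1_card natr_sum.
rewrite -sumrB; apply: eq_bigr => k _.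
by case: (s k); rewrite /= ?expr1 ?expr0 ?mulr1 ?mulr0 ?subr0 // opprD addNKr.
Qed.

Lemma sum_signs_eq0 (C : numClosedFieldType) (p : nat)
    (z : 'I_(p + 1) -> C) (s : 'I_(p + 1) -> bool) :
    prime p -> odd p -> (forall k, z k ^+ p = (-1) ^+ s k) ->
    \sum_k z k = 0 ->
  \sum_k (-1) ^+ s k = 0 :> int.
Proof.
move=> p_pr p_odd zp z_sum0; have p_gt1 := prime_gt1 p_pr.
have := dvd_sum_signs _ _ _ _ _ p_pr p_odd zp z_sum0.
rewrite sum_signs; set t := (\sum_k s k)%N.
have t_le : (t <= p + 1)%N.
  rewrite -[X in (_ <= X)%N]card_ord -sum1_card; apply: leq_sum => k _.
  exact: leq_b1.
case/dvdzP=> c c_eq; rewrite c_eq.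
suff -> : c = 0 by rewrite mul0r.
(* With p = 2h + 1, the equation p + 1 - 2t = c p forces c to be even, while |c p| <= p + 1 < 2p
   forces |c| < 2. *)
have p_half : p = (p./2 * 2 + 1)%N.
  by rewrite muln2 addn1 -{1}[p]odd_double_half p_odd.
move: c_eq p_gt1 t_le; rewrite p_half; move: p./2 => h; nia.
Qed.

(** For signs x, y, z, the number 1 + xy + xz + yz is 4 if all three agree and 0 otherwise. Summed
    over the columns, orthogonality leaves n on one side and four times the number of agreeing
    columns on the other. *)
Lemma dvd4_orthogonal_sign_rows (n : nat) (a b c : 'I_n -> bool) :
    \sum_k (-1) ^+ (a k (+) b k) = 0 :> int ->
    \sum_k (-1) ^+ (a k (+) c k) = 0 :> int ->
    \sum_k (-1) ^+ (b k (+) c k) = 0 :> int ->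
  (4 %| n)%N.
Proof.
move=> ab ac bc.
suff n_eq : n%:Z = 4 * (\sum_k ((a k == b k) && (a k == c k))%N)%:Z by lia.
transitivity (\sum_(k < n) (1 : int) + \sum_k (-1) ^+ (a k (+) b k)
   + \sum_k (-1) ^+ (a k (+) c k) + \sum_k (-1) ^+ (b k (+) c k)).
  by rewrite ab ac bc !addr0 sumr_const card_ord natz.
rewrite -!big_split /= -natz natr_sum mulr_sumr; apply: eq_bigr => k _.
by case: (a k) (b k) (c k) => [] [] [].
Qed.

Lemma unity_root_sign (F : idomainType) (p : nat) (x : F) :
  (2 * p).-unity_root x -> x ^+ p = (-1) ^+ (x ^+ p != 1).
Proof.
move/unity_rootP; rewrite mulnC exprM => /eqP; rewrite sqrf_eq1.
by case: eqP => //= _ /eqP.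
Qed.

Lemma butson_hadamard_sign_orthogonal (C : numClosedFieldType) (p : nat)
    (H : 'M[C]_(p + 1)) (i j : 'I_(p + 1)) :
    prime p -> odd p -> butson_hadamard (2 * p) H -> i != j ->
  \sum_k (-1) ^+ ((H i k ^+ p != 1) (+) (H j k ^+ p != 1)) = 0 :> int.
Proof.
move=> p_pr p_odd [H_unity H_orth] ij.
apply: (@sum_signs_eq0 _ _ (fun k => H i k * (H j k)^*)) => //.
  (* The p-th powers of the entries are signs, hence fixed by conjugation, and their product is the
     sign of the exclusive or. *)
  move=> k; rewrite exprMn -rmorphXn /=.
  rewrite {1}(unity_root_sign _ _ (H i k)) // {1}(unity_root_sign _ _ (H j k)) //.
  by rewrite rmorph_sign -signr_addb.
by rewrite -[RHS](H_orth i j ij); apply: eq_bigr => k _; rewrite !mxE.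
Qed.

Theorem theorem2p3 (R : realType) (p : nat) (p_prime : prime p)
    (p_mod4 : p = 1 %[mod 4]) :
  ~ exists H : 'M[R[i]]_(p + 1), butson_hadamard (2 * p) H.
Proof.
case=> H H_bh; have p_gt1 := prime_gt1 p_prime.
have p_odd : odd p by lia.
have s_orth i j := butson_hadamard_sign_orthogonal _ _ _ i j p_prime p_odd H_bh.
have [lt0 lt1 lt2] : [/\ (0 < p + 1)%N, (1 < p + 1)%N & (2 < p + 1)%N] by split; lia.
have := dvd4_orthogonal_sign_rows _ _ _ _ (s_orth (Ordinal lt0) (Ordinal lt1) isT)
  (s_orth (Ordinal lt0) (Ordinal lt2) isT) (s_orth (Ordinal lt1) (Ordinal lt2) isT).
(* Here p + 1 is 2 modulo 4. *)
lia.
Qed.
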